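(* Let $N,j,n\ge0$ be integers. Let $S_{N,j}(n)$ be the number of partitions $\pi$ into distinct parts, all $\le N$, with $\mathcal{O}(\pi)=n$ and $\gamma(\pi)=j$. Let $\Gamma_{N,j}(n)$ be the number of partitions of $n$ into exactly $j$ parts whose largest hook length is $\le N$. Then $S_{N,j}(n)=\Gamma_{N,j}(n)$.
   Context: A partition $\pi=(\lambda_1,\lambda_2,\dots)$ is a finite non-increasing sequence of positive integers; the empty sequence is the unique partition of $0$. $\mathcal{O}(\pi)=\lambda_1+\lambda_3+\cdots$ and $\gamma(\pi)=\lambda_1-\lambda_2+\lambda_3-\lambda_4+\cdots$. The largest hook length of a nonempty partition is (number of parts) + (largest part) $-1$ (the hook length of the top-left box of its Ferrers diagram), and $0$ for the empty partition. *)

(* Defs.v *)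
From mathcomp Require Import all_boot all_order all_algebra.

Set Implicit Arguments.
Unset Strict Implicit.
Unset Printing Implicit Defensive.

Definition is_partition (p : seq nat) : bool := sorted geq p && (0 \notin p).

(* Indices start at 0, so lambda_1, lambda_3, ... sit at even
   positions. *)
Definition odd_index_sum (p : seq nat) : nat :=
  \sum_(i < size p | ~~ odd i) nth 0 p i.

(* Valued in int, so that no truncated subtraction is involved. *)
Definition alternating_sum (p : seq nat) : int :=
  (\sum_(i < size p) (-1) ^+ i * (nth 0%N p i)%:Z)%R.

Definition largest_hook (p : seq nat) : nat :=
  if nilp p then 0 else size p + head 0 p - 1.

Definition S_pred (N j n : nat) : pred (seq nat) := fun p =>
  [&& is_partition p, uniq p, all (fun x => x <= N) p,
      odd_index_sum p == n & alternating_sum p == j%:Z%R].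

Definition Gamma_pred (N j n : nat) : pred (seq nat) := fun p =>
  [&& is_partition p, sumn p == n, size p == j & largest_hook p <= N].

(* The number of sequences satisfying P among those with at most b entries, all
   at most b. The bounds used below discard nothing: see S_exact and
   Gamma_exact. *)
Definition count_bounded (b : nat) (P : pred (seq nat)) : nat :=
  #|[set s : b.-bseq 'I_b.+1 | P [seq val x | x <- s]]|.

Definition S_count (N j n : nat) : nat := count_bounded N (S_pred N j n).

Definition Gamma_count (N j n : nat) : nat := count_bounded n (Gamma_pred N j n).

Lemma count_bounded_exact (b : nat) (P : pred (seq nat)) (l : seq (seq nat)) :
    (forall p, P p -> (size p <= b) && all (fun x => x <= b) p) ->
    uniq l -> (forall p, (p \in l) = P p) ->
  count_bounded b P = size l.
Proof.
move=> Pb Ul lP; rewrite /count_bounded cardE.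
pose f (s : b.-bseq 'I_b.+1) := [seq val x | x <- s].
have f_inj : injective f.
  by move=> s t /(inj_map val_inj) st; apply: val_inj.
set A := enum _; rewrite -(size_map f A); apply: perm_size.
apply: uniq_perm => //; first by rewrite map_inj_uniq // enum_uniq.
move=> p; rewrite lP; apply/mapP/idP => [[s]|Pp].
  by rewrite mem_enum inE => Ps ->.
have /andP[sp ap] := Pb p Pp.
have sz : size [seq inord x : 'I_b.+1 | x <- p] <= b by rewrite size_map.
have fE : f (Bseq sz) = p.
  rewrite /f /= -map_comp -[RHS]map_id; apply/eq_in_map => x /(allP ap) xb /=.
  by rewrite inordK.
by exists (Bseq sz); rewrite ?fE // mem_enum inE; move: Pp; rewrite -{1}fE.
Qed.

Lemma S_exact (N j n : nat) (l : seq (seq nat)) :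
  uniq l -> (forall p, (p \in l) = S_pred N j n p) -> S_count N j n = size l.
Proof.
apply: count_bounded_exact => p /and5P[/andP[_ p0] Up pN _ _].
rewrite pN andbT -(size_iota 1 N); apply: uniq_leq_size => // x xp.
rewrite mem_iota add1n ltnS (allP pN) // andbT lt0n.
by apply: contraNneq p0 => <-.
Qed.

Lemma Gamma_exact (N j n : nat) (l : seq (seq nat)) :
  uniq l -> (forall p, (p \in l) = Gamma_pred N j n p) ->
  Gamma_count N j n = size l.
Proof.
apply: count_bounded_exact => p /and4P[/andP[_ p0] /eqP <- _ _] {N j n l}.
elim: p p0 => //= x p IHp; rewrite inE negb_or eq_sym -lt0n => /andP[x0 /IHp].
move=> /andP[sp ap]; rewrite leq_addr /= -add1n leq_add //=.
by apply: sub_all ap => y /leq_trans; apply; rewrite leq_addl.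
Qed.

(* Main.v *)
Require Import Defs.
From mathcomp Require Import all_boot all_order all_algebra.
From mathcomp Require Import zify.

(** Write [gamma_i] for the alternating sum of the parts of [lambda] from the
    [i]-th on. Then [gamma_i + gamma_(i+1) = lambda_i], so
    [gamma_1 + gamma_2 + ...] is the sum of the odd-indexed parts. The map
    [stack], given by
    [stack (x :: s) = gamma (x :: s) :: conjugate (stack s)], is a bijection
    from partitions into distinct parts to all partitions. The first row of
    [stack (x :: s)] is [gamma (x :: s)] and it has [1 + gamma s] rows, so its
    largest hook is [gamma (x :: s) + gamma s = x]. Conjugating once more turns
    the largest part into the number of parts. *)

Set Implicit Arguments.
Unset Strict Implicit.
Unset Printing Implicit Defensive.

(** * Partitions built one part at a time *)

Lemma is_partition_cons (x : nat) (s : seq nat) :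
  is_partition (x :: s) = [&& 0 < x, head 0 s <= x & is_partition s].
Proof.
rewrite /is_partition inE negb_or eq_sym -lt0n /=.
by case: s => [|y s] //=; case: (0 < x); rewrite ?andbF //= -andbA.
Qed.

Lemma is_partition_behead (s : seq nat) :
  is_partition s -> is_partition (behead s).
Proof. by case: s => // x s; rewrite is_partition_cons => /and3P[]. Qed.

Lemma partition_nth_le_head (p : seq nat) (i : nat) :
  is_partition p -> nth 0 p i <= head 0 p.
Proof.
elim: p i => [|x p IHp] [|i] //=; rewrite is_partition_cons => /and3P[_ px pp].
exact: leq_trans (IHp i pp) px.
Qed.

(** This turns distinctness into one strict inequality at the head, the form in which the inductions
    below use it. *)
Lemma distinct_partition_cons (x : nat) (s : seq nat) :
  is_partition (x :: s) && uniq (x :: s) =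
  (head 0 s < x) && (is_partition s && uniq s).
Proof.
rewrite is_partition_cons /=.
have [/andP[ps us]|] := boolP (is_partition s && uniq s); last first.
  by rewrite andbF; case: is_partition; case: uniq; rewrite ?andbF.
rewrite ps us !andbT; case: s ps {us} => [|y s] ps /=.
  by rewrite leq0n !andbT.
have y0 : 0 < y by move: ps; rewrite is_partition_cons => /and3P[].
apply/idP/idP => [/andP[/andP[_ yx]]|yx].
  by rewrite inE negb_or => /andP[xy _]; rewrite ltn_neqAle eq_sym xy.
rewrite (ltn_trans y0 yx) (ltnW yx) /=; apply/negP => xys.
(* A second occurrence of [x] would lie in [y :: s], whose entries are at most [y < x]. *)
have /(_ (index x (y :: s))) := partition_nth_le_head _ ps.
by rewrite nth_index //= leqNgt yx.
Qed.

(** * Conjugation of partitions *)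

Definition conjugate (p : seq nat) : seq nat :=
  mkseq (fun i => count (ltn i) p) (head 0 p).

Lemma size_conjugate (p : seq nat) : size (conjugate p) = head 0 p.
Proof. by rewrite size_mkseq. Qed.

Lemma head_conjugate (p : seq nat) :
  is_partition p -> head 0 (conjugate p) = size p.
Proof.
case: p => [|x p] // pp; have /andP[_ p0] := pp.
move: pp; rewrite is_partition_cons => /andP[x0 _]; rewrite -nth0 nth_mkseq //; apply/eqP; rewrite -all_count.
by apply/allP => -[|y] //= p1; case/negP: p0.
Qed.

(** The parts larger than [k] form an initial segment, since parts do not increase. This symmetry
    between rows and columns drives [conjugateK]. *)
Lemma ltn_count_nth (p : seq nat) (i k : nat) :
  is_partition p -> (i < count (ltn k) p) = (k < nth 0 p i).
Proof.
elim: p i => [|x p IHp] i pp; first by rewrite nth_nil.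
have pp' := is_partition_behead pp; rewrite [count _ _]/=.
have [kx|xk] := ltnP k x.
  by case: i => [|i] /=; rewrite ?kx // add1n ltnS IHp.
(* When the first part is at most [k], so is every part, and both sides are false. *)
rewrite add0n IHp // !ltnNge (leq_trans (partition_nth_le_head i.+1 pp)) //.
by rewrite (leq_trans (partition_nth_le_head i pp)).
Qed.

Lemma conjugate_partition (p : seq nat) :
  is_partition p -> is_partition (conjugate p).
Proof.
move=> pp; apply/andP; split.
  apply/(sortedP 0) => i; rewrite size_conjugate => ip.
  rewrite !nth_mkseq ?(ltnW ip) //.
  by apply: sub_count => x /=; apply: ltn_trans.
apply/mapP => -[i]; rewrite mem_iota add0n => /andP[_ ip] /esym/eqP.
by rewrite eqn0Ngt ltn_count_nth // nth0 ip.
Qed.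

Lemma count_ltn_iota (k m : nat) : k <= m -> count (ltn^~ k) (iota 0 m) = k.
Proof.
move=> km; rewrite -(subnKC km) iotaD count_cat add0n.
have -> : count (ltn^~ k) (iota 0 k) = k.
  rewrite -[RHS](size_iota 0); apply/eqP; rewrite -all_count.
  by apply/allP => i; rewrite mem_iota add0n.
rewrite (_ : count _ _ = 0) ?addn0 //; apply/eqP; rewrite -leqn0 leqNgt -has_count.
by apply/hasPn => i; rewrite mem_iota -leqNgt => /andP[].
Qed.

Lemma conjugateK (p : seq nat) : is_partition p -> conjugate (conjugate p) = p.
Proof.
move=> pp; have sz : size (conjugate (conjugate p)) = size p.
  by rewrite size_conjugate head_conjugate.
apply: (@eq_from_nth _ 0) => // i; rewrite sz => ip.
rewrite nth_mkseq ?head_conjugate // count_map.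
(* A part is the number of column indices [k] below it, and all of them lie below the largest
   part. *)
rewrite -[RHS](@count_ltn_iota _ (head 0 p)) ?partition_nth_le_head //.
by apply: eq_count => k /=; rewrite ltn_count_nth.
Qed.

(** Double counting of the cells, by columns and by rows. *)
Lemma sumn_conjugate (p : seq nat) : is_partition p -> sumn (conjugate p) = sumn p.
Proof.
move=> pp; rewrite sumnE big_map [RHS]sumnE.
under eq_bigr do rewrite -sum1_count big_mkcond.
rewrite exchange_big /=; apply: eq_big_seq => x xp.
rewrite -big_mkcond sum1_count count_ltn_iota //.
by rewrite -(nth_index 0 xp) partition_nth_le_head.
Qed.

(** * Alternating sums and odd-indexed parts *)

(* On a partition the truncated subtraction is exact, by [alt_le_head]. *)
Fixpoint alt (s : seq nat) : nat := if s is x :: s' then x - alt s' else 0.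

Lemma alt_le_head (s : seq nat) : alt s <= head 0 s.
Proof. by case: s => //= x s; rewrite leq_subr. Qed.

Lemma alt_cons (x : nat) (s : seq nat) :
  is_partition (x :: s) -> alt (x :: s) + alt s = x.
Proof.
rewrite is_partition_cons => /and3P[_ sx _] /=.
by rewrite subnK // (leq_trans (alt_le_head s)).
Qed.

Lemma alternating_sum_cons (x : nat) (s : seq nat) :
  alternating_sum (x :: s) = (x%:Z - alternating_sum s)%R.
Proof.
rewrite /alternating_sum big_ord_recl /= GRing.expr0 GRing.mul1r; congr (_ + _)%R.
rewrite -GRing.sumrN; apply: eq_bigr => i _.
by rewrite GRing.exprS GRing.mulN1r GRing.mulNr.
Qed.

Lemma alternating_sumE (s : seq nat) :
  is_partition s -> alternating_sum s = (alt s)%:Z%R.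
Proof.
elim: s => [|x s IHs] ps; first by rewrite /alternating_sum big_ord0.
rewrite alternating_sum_cons IHs ?(is_partition_behead ps) //.
by have := alt_cons ps; lia.
Qed.

Lemma odd_index_sum_cons2 (x y : nat) (s : seq nat) :
  odd_index_sum [:: x, y & s] = x + odd_index_sum s.
Proof.
rewrite /odd_index_sum !(big_mkcond (fun i => ~~ odd _)) !big_ord_recl /= add0n.
by congr (_ + _); apply: eq_bigr => i _; rewrite negbK.
Qed.

Lemma odd_index_sum_cons (x : nat) (s : seq nat) :
  is_partition (x :: s) ->
  odd_index_sum (x :: s) = alt (x :: s) + odd_index_sum s.
Proof.
elim: s x => [|y s IHs] x ps.
  rewrite /odd_index_sum (big_mkcond (fun i => ~~ odd _)).
  by rewrite big_ord_recl !big_ord0 /= subn0.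
have ps' := is_partition_behead ps.
rewrite odd_index_sum_cons2 (IHs y ps').
by have := alt_cons ps; have := alt_cons ps'; lia.
Qed.

(** * The bijection [stack] *)

Fixpoint stack (s : seq nat) : seq nat :=
  if s is _ :: s' then alt s :: conjugate (stack s') else [::].

Lemma head_stack (s : seq nat) : head 0 (stack s) = alt s.
Proof. by case: s. Qed.

Lemma size_stack_cons (x : nat) (s : seq nat) :
  size (stack (x :: s)) = (alt s).+1.
Proof. by rewrite /= size_conjugate head_stack. Qed.

(** A new row [x] fits above [conjugate (stack s)] exactly when [x + alt s], the part it stands for,
    exceeds the head of [s]. Indeed for [s = y :: s'] the size is [1 + alt s'], and
    [y = alt s + alt s']. Both well-definedness and surjectivity of [stack] rest on this. *)
Lemma size_stack_le (x : nat) (s : seq nat) :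
  0 < x -> is_partition s ->
  (size (stack s) <= x) = (head 0 s < x + alt s).
Proof.
case: s => [|y s] x0 ps; first by rewrite /= addn0 x0.
by rewrite size_stack_cons; have := alt_cons ps; rewrite [head _ _]/=; lia.
Qed.

Lemma stack_partition (s : seq nat) :
  is_partition s && uniq s -> is_partition (stack s).
Proof.
elim: s => // x s IHs /[dup] /andP[pxs _].
rewrite distinct_partition_cons => /andP[sx ds].
have /andP[ps _] := ds; have pst := IHs ds; have ax := alt_cons pxs.
have as_le := alt_le_head s.
(* Here [alt s <= head 0 s < x], while [alt (x :: s) + alt s = x]. *)
have a0 : 0 < alt (x :: s) by lia.
rewrite [stack _]/= is_partition_cons conjugate_partition // head_conjugate //.
by rewrite -/(alt (x :: s)) size_stack_le // ax sx a0.
Qed.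

Lemma sumn_stack (s : seq nat) :
  is_partition s && uniq s -> sumn (stack s) = odd_index_sum s.
Proof.
elim: s => [|x s IHs]; first by rewrite /odd_index_sum big_ord0.
move=> /[dup] /andP[pxs _]; rewrite distinct_partition_cons => /andP[_ ds].
by rewrite odd_index_sum_cons // -IHs // -(sumn_conjugate (stack_partition ds)).
Qed.

(** The tail of the image determines [s] by conjugation and induction; then the first row and
    [alt s] add up to the first part. *)
Lemma stack_inj :
  {in [pred s | is_partition s && uniq s] &, injective stack}.
Proof.
elim=> [|x s IHs] [|y t] //; rewrite !inE => ds dt [eq_alt eq_tl].
have /andP[ps _] := ds; have /andP[pt _] := dt.
move: ds dt; rewrite !distinct_partition_cons => /andP[_ ds] /andP[_ dt].
have st : s = t.
  apply: IHs => //; rewrite -(conjugateK (stack_partition ds)) eq_tl.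
  by rewrite conjugateK ?stack_partition.
subst t; congr (_ :: _).
by rewrite -(alt_cons ps) -(alt_cons pt) /= eq_alt.
Qed.

(** The induction is on the sum rather than on the list, because the preimage is sought for the
    conjugate of the tail. The sum drops strictly since the first row is positive. *)
Lemma stack_surj (p : seq nat) :
  is_partition p -> exists2 s, is_partition s && uniq s & stack s = p.
Proof.
have [m] := ubnP (sumn p); elim: m p => // m IHm [|c q] pm pp.
  by exists [::].
have pq := is_partition_behead pp; have cpq := conjugate_partition pq.
move: pp; rewrite is_partition_cons => /and3P[c0 qc _].
have [|s ds sE] := IHm (conjugate q) _ cpq.
  by rewrite sumn_conjugate //; move: pm => /=; lia.
(* By [alt_cons], a first row [c] over a tail coming from [s] forces the first part to be
   [c + alt s]. *)
have /andP[ps _] := ds; exists (c + alt s :: s).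
  rewrite distinct_partition_cons ds andbT.
  by move: qc; rewrite -size_conjugate -sE size_stack_le.
by rewrite /= addnK sE conjugateK.
Qed.

(** * Transport of the statistics and comparison of the counts *)

Definition hook_map (s : seq nat) : seq nat := conjugate (stack s).

Lemma hook_map_partition (s : seq nat) :
  is_partition s && uniq s -> is_partition (hook_map s).
Proof. by move=> /stack_partition/conjugate_partition. Qed.

Lemma largest_hook_hook_map (s : seq nat) :
  is_partition s && uniq s -> largest_hook (hook_map s) = head 0 s.
Proof.
case: s => // x s ds; have /andP[ps _] := ds.
have a0 : 0 < alt (x :: s).
  by have := stack_partition ds; rewrite /= is_partition_cons => /andP[].
rewrite /largest_hook /nilp /hook_map size_conjugate head_stack eqn0Ngt a0.
by rewrite head_conjugate ?stack_partition // size_stack_cons addnS subn1 alt_cons.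
Qed.

Lemma all_leq_head (N : nat) (s : seq nat) :
  is_partition s -> all (leq^~ N) s = (head 0 s <= N).
Proof.
move=> ps; apply/allP/idP => [sN|sN x xs].
  by case: s sN {ps} => //= x s; apply; rewrite mem_head.
by rewrite -(nth_index 0 xs) (leq_trans (partition_nth_le_head _ ps)).
Qed.

Lemma Gamma_pred_hook_map (N j n : nat) (s : seq nat) :
  is_partition s && uniq s -> Gamma_pred N j n (hook_map s) = S_pred N j n s.
Proof.
move=> ds; have /andP[ps us] := ds.
rewrite /Gamma_pred /S_pred hook_map_partition // largest_hook_hook_map //.
rewrite ps us all_leq_head // alternating_sumE // eqz_nat.
rewrite sumn_conjugate ?stack_partition // sumn_stack // size_conjugate head_stack.
by rewrite /= andbA andbC.
Qed.

(** This supplies the list of strict partitions whose image under [hook_map] is then shown to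
    enumerate the other side. *)
Lemma bounded_enum (b : nat) (P : pred (seq nat)) :
    (forall p, P p -> (size p <= b) && all (leq^~ b) p) ->
  exists2 l, uniq l & forall p, (p \in l) = P p.
Proof.
move=> Pb; pose f (s : b.-bseq 'I_b.+1) := [seq val x | x <- s].
exists (undup [seq p <- [seq f s | s : b.-bseq 'I_b.+1] | P p]) => [|p].
  exact: undup_uniq.
rewrite mem_undup mem_filter; case Pp: (P p) => //=.
have /andP[sp /allP ap] := Pb p Pp.
have sz : size [seq inord x : 'I_b.+1 | x <- p] <= b by rewrite size_map.
apply/codomP; exists (Bseq sz); rewrite /f /= -map_comp -[LHS]map_id.
by apply/eq_in_map => x /ap xb /=; rewrite inordK.
Qed.

Lemma S_pred_bounded (N j n : nat) (p : seq nat) :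
  S_pred N j n p -> (size p <= N) && all (leq^~ N) p.
Proof.
case/and5P=> /andP[_ p0] Up pN _ _; rewrite pN andbT -(size_iota 1 N).
apply: uniq_leq_size => // x xp; rewrite mem_iota add1n ltnS (allP pN) // andbT.
by rewrite lt0n; apply: contraNneq p0 => <-.
Qed.

Theorem theorem3p5 (N j n : nat) : S_count N j n = Gamma_count N j n.
Proof.
have [l ul lS] := bounded_enum (@S_pred_bounded N j n).
have lD s : s \in l -> is_partition s && uniq s.
  by rewrite lS => /and5P[-> ->].
rewrite (S_exact ul lS) -(size_map hook_map); apply/esym/Gamma_exact => [|p].
  rewrite map_inj_in_uniq // => s t /lD ds /lD dt eq_st.
  apply: stack_inj => //; rewrite -(conjugateK (stack_partition ds)).
  by rewrite -/(hook_map s) eq_st conjugateK ?stack_partition.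
apply/mapP/idP => [[s sl ->]|Gp].
  by rewrite Gamma_pred_hook_map ?lD // -lS.
(* The preimage of [p] under [hook_map] is the preimage of its conjugate under [stack]. *)
have /andP[pp _] := Gp; have [s ds sE] := stack_surj (conjugate_partition pp).
have pE : p = hook_map s by rewrite /hook_map sE conjugateK.
by exists s => //; rewrite lS -Gamma_pred_hook_map // -pE.
Qed.
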